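(* Let $\mathcal{A} = \{uv^T : u,v\in\mathbb{R}^d\}$, equipped with its Borel $\sigma$-algebra. Let $A_{\sigma_1},A_{\sigma_2},\dots$ be an ergodic stationary process taking values in $\mathcal{A}$, and let $P$ denote the marginal distribution of $(A_{\sigma_1},A_{\sigma_2})$. Suppose that $$\mathbb{E}\,\bigl|\log\|A_{\sigma_1}\|\bigr| < \infty \quad\text{and}\quad \int \bigl|\log|u^Tv'|\bigr|\, dP(uv^T,u'v'^T) < \infty .$$ Then the (random) limit $$\lim_{k\to\infty}\frac1k \log\|A_{\sigma_k}\cdots A_{\sigma_1}\|$$ exists almost surely, and moreover $$\frac1k\log\|A_{\sigma_k}\cdots A_{\sigma_1}\| \;\to\; \int \log|u^Tv'|\, dP(uv^T,u'v'^T)$$ almost surely and in $L_1$ as $k\to\infty$.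
   Context: The Borel $\sigma$-algebra on $\mathcal{A}\subset\mathbb{R}^{d\times d}$ is the one arising from any norm on $\mathbb{R}^{d\times d}$, and $\|\cdot\|$ is any norm on $\mathbb{R}^{d\times d}$. The process is stationary if $(A_{\sigma_1},\dots,A_{\sigma_k})$ has the same distribution as $(A_{\sigma_{\tau+1}},\dots,A_{\sigma_{\tau+k}})$ for all $k,\tau\in\mathbb{N}$; it is ergodic if every shift-invariant event has probability $0$ or $1$. In the integrals, each matrix in $\mathcal{A}$ is written as $uv^T$ via a fixed measurable choice of such a decomposition, so that $u$ comes from the decomposition of the first matrix and $v'$ from that of the second matrix of the pair. Logarithms are natural, $\log 0=-\infty$. *)

(* Defs.v *)
From HB Require Import structures.
From mathcomp Require Import all_boot all_order all_algebra.
From mathcomp Require Import all_classical all_reals all_analysis.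

Set Implicit Arguments.
Unset Strict Implicit.
Unset Printing Implicit Defensive.

Import Order.TTheory GRing.Theory Num.Theory numFieldNormedType.Exports.
Local Open Scope classical_set_scope.
Local Open Scope ring_scope.

(* The topology on matrices is that of entrywise convergence, i.e. the one
   induced by every norm. *)
Definition colvec (R : realType) (d : nat) : Type :=
  g_sigma_algebraType (@open 'cV[R]_d).

Definition outer_products (R : realType) (d : nat) : set 'M[R]_d :=
  [set A | exists u v : 'cV[R]_d, A = u *m v^T].
Arguments outer_products : clear implicits.

Lemma outer_products0 (R : realType) (d : nat) :
  (0 : 'M[R]_d) \in outer_products R d.
Proof. by rewrite inE; exists 0, 0; rewrite mul0mx. Qed.

Definition outer_type (R : realType) (d : nat) : Type :=
  set_type (outer_products R d).
HB.instance Definition _ (R : realType) (d : nat) :=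
  Topological.copy (outer_type R d) (set_type (outer_products R d)).
HB.instance Definition _ (R : realType) (d : nat) :=
  isPointed.Build (outer_type R d) (SigSub (outer_products0 R d)).

Definition outer (R : realType) (d : nat) : Type :=
  g_sigma_algebraType (@open (outer_type R d)).

Definition outer_mx (R : realType) (d : nat) (A : outer R d) : 'M[R]_d :=
  \val (A : set_type (outer_products R d)).

Record is_norm (R : realType) (V : lmodType R) (N : V -> R) : Prop := IsNorm {
  is_norm_triangle : forall x y, N (x + y) <= N x + N y ;
  is_norm_homogeneous : forall a x, N (a *: x) = `|a| * N x ;
  is_norm_definite : forall x, N x = 0 -> x = 0 }.

Section processes.
Context {dO dS : measure_display} {Omega : measurableType dO}
  {S : measurableType dS} {R : realType}.
Variables (Pr : probability Omega R) (X : nat -> {mfun Omega >-> S}).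

Definition block (t k : nat) (w : Omega) : k.-tuple S :=
  [tuple X (t + i)%N w | i < k].

Definition stationary : Prop :=
  forall (k t : nat) (B : set (k.-tuple S)), measurable B ->
    pushforward Pr (block t k) B = pushforward Pr (block 0%N k) B.

Definition cylinder_sigma : set (set (nat -> S)) :=
  <<s \bigcup_i preimage_set_system setT (fun x : nat -> S => x i) measurable >>.

Definition shift (x : nat -> S) : nat -> S := fun i => x i.+1.

Definition ergodic : Prop :=
  forall B : set (nat -> S), cylinder_sigma B -> shift @^-1` B = B ->
    Pr [set w | B (fun i => X i w)] = 0%E \/
    Pr [set w | B (fun i => X i w)] = 1%E.

Definition pair_law : set (S * S) -> \bar R :=
  pushforward Pr (fun w => (X 0%N w, X 1%N w)).

End processes.

(* [lprod A k] is A_(k-1) *m ... *m A_0. *)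
Fixpoint lprod (R : realType) (d : nat) (A : nat -> 'M[R]_d) (k : nat) :
    'M[R]_d :=
  if k is k'.+1 then A k' *m lprod A k' else 1%:M.

(* The process is indexed from 0, so that [X i] stands for the (i+1)-st matrix.
   Logarithms are taken in the extended reals because log 0 is -oo. *)
Definition mean_log_norm (R : realType) (d : nat) (N : 'M[R]_d -> R)
    (A : nat -> 'M[R]_d) (k : nat) : \bar R :=
  ((k%:R^-1)%:E * lne (N (lprod A k))%:E)%E.

(* Main.v *)
Require Import Defs.
From HB Require Import structures.
From mathcomp Require Import all_boot all_order all_algebra.
From mathcomp Require Import all_classical all_reals all_analysis.
From mathcomp Require Import measurable_realfun ring lra.

Set Implicit Arguments.
Unset Strict Implicit.
Unset Printing Implicit Defensive.

Import Order.TTheory GRing.Theory Num.Theory numFieldNormedType.Exports.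
Local Open Scope classical_set_scope.
Local Open Scope ring_scope.

(** A product of rank-one matrices A_i = u_i v_i^T telescopes:

      A_n ... A_0 = (prod_(i < n) u_i^T v_(i+1)) u_n v_0^T,

    so that log |A_n ... A_0| is the sum of the log |u_i^T v_(i+1)| over i < n
    plus the boundary term log |u_n v_0^T|.  The sum is a Birkhoff sum over
    the stationary ergodic process, and the ergodic theorem gives its mean.

    The delicate point is the boundary term.  Only log |u_i| + log |v_i|,
    which is log |A_i| up to a constant, is known to be integrable: the two
    factors may be rescaled against each other by an arbitrary measurable
    function of A_i, so log |u_i| and log |v_i| need not be integrable
    separately.  Put a_i = log |u_i|.  Then

      log |u_n v_0^T| = (a_n - a_0) + log |A_0| + O(1),

    and a_n - a_0 is the Birkhoff sum of the coboundary a_(i+1) - a_i.  The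
    Cauchy-Schwarz type bound |u_i^T v_(i+1)| <= d |u_i| |v_(i+1)| reads

      a_(i+1) - a_i <= log d + log |A_(i+1)| - log |u_i^T v_(i+1)|,

    so the coboundary is bounded above by an integrable function, and a
    measurable coboundary with this property is automatically integrable with
    mean 0 ([coboundary_integrable], [integral_coboundary]).  Hence the
    function h = log |u_0^T v_1| + (a_1 - a_0) is integrable with mean lambda,
    and [mean_log_bound] gives, almost surely and for all n,

      |(n+1)^-1 log |A_n ... A_0| - lambda|
        <= |n^-1 S_n h - lambda| + (n+1)^-1 (C + |lambda| + |log |A_0||).

    Almost sure convergence, integrability and convergence in L1 all follow
    from this inequality ([perturbation_ae], [perturbation_integrable],
    [perturbation_L1]) and from Birkhoff's theorem for h in its pointwise and
    L1 forms ([birkhoff_ae], [birkhoff_L1]).  The process carries no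
    transformation of its probability space, so these are applied to the shift
    on the space of sequences, equipped with the law of the process.

    Any norm is within multiplicative constants of the maximum norm
    ([is_norm_ln_comparison]), for which |u v^T| = |u| |v| exactly. *)

(** * Measure-preserving maps and coboundaries *)

Section measure_preserving.
Context d (Y : measurableType d) (R : realType) (mu : probability Y R).
Variable T : Y -> Y.
Hypothesis mT : measurable_fun [set: Y] T.
Hypothesis muT : forall B, measurable B -> mu (T @^-1` B) = mu B.
Local Open Scope ereal_scope.

Lemma ge0_integral_preserving (f : Y -> \bar R) :
  measurable_fun setT f -> (forall x, 0 <= f x) ->
  \int[mu]_x f (T x) = \int[mu]_x f x.
Proof.
move=> mf f0; transitivity (\int[pushforward mu T]_x f x).
  by rewrite (ge0_integral_pushforward mT)// preimage_setT.
by apply: eq_measure_integral => A mA _; exact: muT.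
Qed.

Lemma integrable_preserving (f : Y -> \bar R) :
  mu.-integrable setT f -> mu.-integrable setT (f \o T).
Proof.
move=> /integrableP[mf foo]; apply/integrableP; split.
  exact: measurableT_comp.
have := @ge0_integral_preserving (abse \o f) _ _.
by move=> /= -> //; exact: measurableT_comp.
Qed.

Lemma integral_preserving (f : Y -> \bar R) :
  mu.-integrable setT f -> \int[mu]_x f (T x) = \int[mu]_x f x.
Proof.
move=> fi; have mf := measurable_int _ fi.
transitivity (\int[pushforward mu T]_x f x).
  rewrite (integral_pushforward mT)// ?preimage_setT//.
  exact: integrable_preserving.
by apply: eq_measure_integral => A mA _; exact: muT.
Qed.

Lemma ae_preserving (P : Y -> Prop) :
  {ae mu, forall x, P x} -> {ae mu, forall x, P (T x)}.
Proof.
move=> [A [mA A0 PA]]; exists (T @^-1` A); split.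
- by rewrite -[X in measurable X]setTI; exact: mT.
- by rewrite muT.
- by move=> x /= nP; exact: PA.
Qed.

Lemma ae_iter_preserving (P : Y -> Prop) :
  {ae mu, forall x, P x} -> {ae mu, forall x n, P (iter n T x)}.
Proof.
move=> aeP; apply: ae_foralln; elim=> [//|n IH].
by have := ae_preserving IH; apply: filterS => x; rewrite iterSr.
Qed.

End measure_preserving.

Section clipping.
Variable R : realType.
Implicit Types x y z : R.

(** Truncation of [x] to the interval [[-n, n]]; being nondecreasing and
    1-Lipschitz, it cannot increase the positive part of a difference. *)
Definition clip (n : nat) x : R := Num.max (- n%:R) (Num.min n%:R x).

Lemma clip_bound n x : `|clip n x| <= n%:R.
Proof.
have n0 : (0 : R) <= n%:R by [].
rewrite /clip ler_norml ge_max le_max ge_min !lexx /=; lra.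
Qed.

Lemma clip_id n x : `|x| <= n%:R -> clip n x = x.
Proof. by rewrite ler_norml /clip => /andP[? ?]; rewrite min_r// max_r. Qed.

Lemma clipB_le n x y z : 0 <= z -> y - x <= z -> clip n y - clip n x <= z.
Proof.
have n0 : (0 : R) <= n%:R by [].
rewrite /clip => z0 yx; case: (leP (n%:R : R) x) => h; case: (leP (n%:R : R) y) => h';
rewrite /Num.max; repeat case: ifP => ?; lra.
Qed.

Lemma sub2_ge0 x y : 0 <= x -> y <= x -> 0 <= 2 * x - y.
Proof. by move=> ? ?; lra. Qed.

Lemma ler_norm_2sub x y : 0 <= x -> y <= x -> `|y| <= `|2 * x - y|.
Proof.
move=> x0 yx; rewrite (ger0_norm (sub2_ge0 x0 yx)) ler_norml.
by apply/andP; split; lra.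
Qed.

Lemma measurable_clip n : measurable_fun [set: R] (clip n).
Proof.
by apply: measurable_maxr => //; apply: measurable_minr.
Qed.

End clipping.

Section coboundary.
Context d (Y : measurableType d) (R : realType) (mu : probability Y R).
Variable T : Y -> Y.
Hypothesis mT : measurable_fun [set: Y] T.
Hypothesis muT : forall B, measurable B -> mu (T @^-1` B) = mu B.

Variables (a phi : Y -> R).
Hypothesis ma : measurable_fun setT a.
Hypothesis phi_int : mu.-integrable setT (EFin \o phi).
Hypothesis phi0 : forall x, 0 <= phi x.
Hypothesis aphi : {ae mu, forall x, a (T x) - a x <= phi x}.

Let dlt n x := clip n (a (T x)) - clip n (a x).

Let mdlt n : measurable_fun setT (dlt n).
Proof.
apply: measurable_funB => /=.
  exact: (measurableT_comp (measurable_clip n) (measurableT_comp ma mT)).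
exact: (measurableT_comp (measurable_clip n) ma).
Qed.

Let iclip n : mu.-integrable setT (EFin \o (clip n \o a)).
Proof.
apply: measurable_bounded_integrable => //.
- by rewrite (le_lt_trans (probability_le1 _ _)) ?ltry.
- by apply: measurableT_comp => //; exact: measurable_clip.
- exists n%:R; split => // M nM x _; exact: le_trans (clip_bound _ _) (ltW nM).
Qed.

Let idlt n : mu.-integrable setT (EFin \o dlt n).
Proof.
have h := integrableB measurableT (integrable_preserving mT muT (iclip n)) (iclip n).
by apply: eq_integrable h => // x _.
Qed.

Let int_dlt n : (\int[mu]_x (dlt n x)%:E = 0)%E.
Proof.
rewrite (_ : (fun x => _) = ((EFin \o (clip n \o a)) \o T) \- (EFin \o (clip n \o a)))%E//.
rewrite integralB// ?(integral_preserving mT muT)//.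
  by rewrite subee// integrable_fin_num.
exact: integrable_preserving.
Qed.

Let iphi2 : mu.-integrable setT (fun x => 2%:E * (phi x)%:E)%E.
Proof. exact: integrableZl. Qed.

Let int_abs_dlt n : (\int[mu]_x `|(dlt n x)%:E| <= 2%:E * \int[mu]_x (phi x)%:E)%E.
Proof.
have -> : (2%:E * \int[mu]_x (phi x)%:E =
    \int[mu]_x `|(2 * phi x - dlt n x)%:E|)%E.
  transitivity (\int[mu]_x (2%:E * (phi x)%:E - (dlt n x)%:E))%E.
    rewrite integralB//; last exact: idlt.
    by rewrite integralZl// int_dlt sube0.
  apply: ae_eq_integral => //.
  - by apply: (measurable_int mu); apply: integrableB => //; exact: idlt.
  - do 2 apply: measurableT_comp => //; apply: measurable_funB => //.
    apply: measurable_funM => //.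
    exact/measurable_EFinP/(measurable_int _ phi_int).
  apply: filterS aphi => x h _; rewrite /= ger0_norm//.
  by apply: sub2_ge0 => //; exact: clipB_le.
apply: ae_ge0_le_integral => //.
- by do 2 apply: measurableT_comp => //; exact: mdlt.
- do 2 apply: measurableT_comp => //; apply: measurable_funB => //.
  apply: measurable_funM => //.
  exact/measurable_EFinP/(measurable_int _ phi_int).
apply: filterS aphi => x h _; rewrite lee_fin; apply: ler_norm_2sub => //.
exact: clipB_le.
Qed.

Let dlt_cvg x : (dlt n x)%:E @[n --> \oo] --> (a (T x) - a x)%:E.
Proof.
apply: cvg_near_cst.
exists (Num.truncn (`|a x| + `|a (T x)|)).+1 => // n /= nn.
have h : `|a x| + `|a (T x)| <= n%:R.
  by rewrite (le_trans (ltW (truncnS_gt _)))// ler_nat.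
have := normr_ge0 (a x); have := normr_ge0 (a (T x)).
by rewrite /dlt => ? ?; rewrite !clip_id//; lra.
Qed.

Let mcob : measurable_fun setT (fun x => a (T x) - a x).
Proof. by apply: measurable_funB => //; exact: measurableT_comp. Qed.

(** The truncated coboundaries [dlt n] have mean 0 by invariance and are at
    most [phi], so that [|dlt n| <= 2 phi - dlt n] has integral at most twice
    that of [phi]; Fatou's lemma passes to the limit. *)
Lemma coboundary_integrable :
  mu.-integrable setT (fun x => (a (T x) - a x)%:E).
Proof.
apply/integrableP; split; first exact: measurableT_comp.
apply: (@le_lt_trans _ _ (2%:E * \int[mu]_x (phi x)%:E)%E).
  have := @fatou _ _ _ mu _ measurableT (fun n x => `|(dlt n x)%:E|%E).
  rewrite (eq_integral (fun x => `|(a (T x) - a x)%:E|)%E); last first.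
    move=> x _; have h : `|(dlt n x)%:E|%E @[n --> \oo] --> `|(a (T x) - a x)%:E|%E.
      by apply: cvg_abse; exact: dlt_cvg.
    by rewrite is_cvg_limn_einfE; [exact/cvg_lim|apply/cvg_ex; eexists; exact: h].
  move=> F; apply: (le_trans (F _ _)) => //.
    by move=> n; do 2 apply: measurableT_comp => //; exact: mdlt.
  rewrite limn_einf_lim; apply: lime_le.
    exact: is_cvg_einfs.
  apply: nearW => n; apply: le_trans (int_abs_dlt n).
  by apply: ereal_inf_lbound; exists n => /=.
by rewrite -integralZl// integrable_lty.
Qed.

(** The truncated coboundaries have mean 0 and are dominated by the
    coboundary itself. *)
Lemma integral_coboundary : (\int[mu]_x (a (T x) - a x)%:E = 0)%E.
Proof.
have mdltE n : measurable_fun setT (EFin \o dlt n).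
  by apply: measurableT_comp => //; exact: mdlt.
have mcobE : measurable_fun setT (fun x => (a (T x) - a x)%:E).
  exact: measurableT_comp.
have dcvg : {ae mu, forall x, [set: Y] x ->
    (dlt n x)%:E @[n --> \oo] --> (a (T x) - a x)%:E}.
  by apply: aeW => x _; exact: dlt_cvg.
have dom : {ae mu, forall x n, [set: Y] x ->
    (`|(dlt n x)%:E| <= `|(a (T x) - a x)%:E|)%E}.
  apply: aeW => x n _; rewrite lee_fin /dlt ler_norml; apply/andP; split.
    rewrite lerNl opprB; apply: clipB_le => //.
    by rewrite -normrN opprB ler_norm.
  by apply: clipB_le => //; exact: ler_norm.
have [_ _ +] := dominated_convergence measurableT mdltE mcobE dcvg
  (integrable_abse coboundary_integrable) dom.
rewrite /=; under eq_fun do rewrite int_dlt.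
by move=> h; apply/esym; apply: (cvg_unique _ _ h) => //; exact: cvg_cst.
Qed.

End coboundary.

(** * Birkhoff sums and their running maxima *)

Section birkhoff_sum.
Context (Y : Type) (R : realType).
Variable T : Y -> Y.
Implicit Types (f : Y -> R) (x : Y).

Definition birkhoff_sum f n x : R := \sum_(i < n) f (iter i T x).

Lemma birkhoff_sumS f n x :
  birkhoff_sum f n.+1 x = f x + birkhoff_sum f n (T x).
Proof.
rewrite /birkhoff_sum big_ord_recl /=; congr (_ + _).
by apply: eq_bigr => i _; rewrite -iterSr.
Qed.

Lemma birkhoff_sum_cst c n x : birkhoff_sum (fun=> c) n x = n%:R * c.
Proof. by rewrite /birkhoff_sum sumr_const card_ord mulr_natl. Qed.

Lemma birkhoff_sumB f g n x :
  birkhoff_sum (fun y => f y - g y) n x = birkhoff_sum f n x - birkhoff_sum g n x.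
Proof. by rewrite /birkhoff_sum sumrB. Qed.

Lemma birkhoff_sum_coboundary f a n x :
  birkhoff_sum (fun y => f y + (a (T y) - a y)) n x =
  birkhoff_sum f n x + (a (iter n T x) - a x).
Proof.
rewrite /birkhoff_sum big_split /=; congr (_ + _).
elim: n => [|n IH]; first by rewrite big_ord0 subrr.
by rewrite big_ord_recr/= IH; ring.
Qed.

(** The maximum of the Birkhoff sums of length at most [n], the empty one
    included.  The recursion is the form in which it is used: it compares the
    maximum at [x] with the maximum at [T x]. *)
Fixpoint max_birkhoff f n x : R :=
  if n is m.+1 then Num.max 0 (f x + max_birkhoff f m (T x)) else 0.

Lemma max_birkhoff_ge0 f n x : 0 <= max_birkhoff f n x.
Proof. by case: n => //= n; rewrite le_max lexx. Qed.

Lemma birkhoff_sum_le_max f n x : birkhoff_sum f n x <= max_birkhoff f n x.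
Proof.
elim: n x => [|n IH] x; first by rewrite /birkhoff_sum big_ord0.
by rewrite birkhoff_sumS /= le_max lerD2l IH orbT.
Qed.

Lemma max_birkhoff_nd f x : {homo max_birkhoff f ^~ x : m n / (m <= n)%N >-> m <= n}.
Proof.
apply: homo_leq => [//|m n p|n]; first exact: le_trans.
elim: n x => [|n IH] x; first exact: max_birkhoff_ge0.
by rewrite [leLHS]/= [leRHS]/= ge_max !le_max lexx /= lerD2l IH orbT.
Qed.

(** The difference decreases to [f x] as soon as the running maxima at [T x]
    tend to infinity. *)
Lemma max_birkhoffSB f n x : max_birkhoff f n.+1 x - max_birkhoff f n (T x) =
  Num.max (- max_birkhoff f n (T x)) (f x).
Proof. by rewrite /= /Num.max; do 2 case: ifP => ?; lra. Qed.

Lemma max_birkhoffSB_bound f n x :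
  `|max_birkhoff f n.+1 x - max_birkhoff f n (T x)| <= `|f x|.
Proof.
rewrite max_birkhoffSB; have := max_birkhoff_ge0 f n (T x).
move: (max_birkhoff _ _ _) => M M0.
rewrite ler_norml; have := ler_norm (f x); have := ler_norm (- f x).
rewrite normrN /Num.max => ? ?; case: ifP => ?; apply/andP; split; lra.
Qed.

Definition unbounded_birkhoff f : set Y :=
  [set x | forall K : nat, exists n, K%:R < max_birkhoff f n x].

(** The running maxima at [x] and at [T x] differ by at most [|f x|]; the
    invariance is exact, not merely almost sure, because [f] is finite. *)
Lemma unbounded_birkhoff_invariant f :
  T @^-1` unbounded_birkhoff f = unbounded_birkhoff f.
Proof.
apply/seteqP; split => x /= H K.
  have [n hn] := H (Num.truncn (K%:R + `|f x|)).+1.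
  exists n.+1; rewrite /= lt_max; apply/orP; right.
  have := lt_trans (truncnS_gt _) hn; have := ler_norm (- f x).
  by rewrite normrN => ? ?; lra.
have [n hn] := H (Num.truncn (K%:R + `|f x|)).+1.
have : K%:R + `|f x| < max_birkhoff f n x by exact: lt_trans (truncnS_gt _) hn.
case: n {hn} => [|n] /= hn.
  have : (0 : R) <= K%:R by []. have := normr_ge0 (f x) => ? ?; lra.
exists n; have : (0 : R) <= K%:R by [].
have := normr_ge0 (f x); have := ler_norm (f x); move=> ? ? ?.
by move: hn; rewrite lt_max => /orP[?|?]; lra.
Qed.

End birkhoff_sum.

(** * The pointwise and mean ergodic theorems *)

Section birkhoff.
Context d (Y : measurableType d) (R : realType) (mu : probability Y R).
Variable T : Y -> Y.
Hypothesis mT : measurable_fun [set: Y] T.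
Hypothesis muT : forall B, measurable B -> mu (T @^-1` B) = mu B.
Hypothesis ergT : forall B, measurable B -> T @^-1` B = B ->
  mu B = 0%E \/ mu B = 1%E.
Implicit Types f : Y -> R.

Lemma measurable_max_birkhoff f n :
  measurable_fun setT f -> measurable_fun setT (max_birkhoff T f n).
Proof.
move=> mf; elim: n => [|n IH] /=; first exact: measurable_cst.
apply: measurable_maxr => //; apply: measurable_funD => //.
exact: (measurableT_comp IH mT).
Qed.

Lemma measurable_iter n : measurable_fun setT (iter n T).
Proof.
elim: n => [|n IH]; first exact: measurable_id.
by rewrite (_ : iter n.+1 T = T \o iter n T)//; exact: measurableT_comp.
Qed.

Lemma measurable_birkhoff_sum f n :
  measurable_fun setT f -> measurable_fun setT (birkhoff_sum T f n).
Proof.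
move=> mf; apply: measurable_sum => i.
exact: (measurableT_comp mf (measurable_iter i)).
Qed.

Lemma measurable_unbounded_birkhoff f :
  measurable_fun setT f -> measurable (unbounded_birkhoff T f).
Proof.
move=> mf; rewrite [X in measurable X](_ : _ =
  \bigcap_K \bigcup_n (max_birkhoff T f n @^-1` `]K%:R, +oo[)).
  apply: bigcapT_measurable => K; apply: bigcupT_measurable => n.
  rewrite -[X in measurable X]setTI.
  by apply: measurable_max_birkhoff => //; exact: measurable_itv.
apply/seteqP; split => [x H K _|x H K].
  by have [n hn] := H K; exists n => //=; rewrite in_itv/= andbT.
by have [n _] := H K I; rewrite /= in_itv/= andbT; exists n.
Qed.

Lemma integrable_max_birkhoff f n : mu.-integrable setT (EFin \o f) ->
  mu.-integrable setT (EFin \o max_birkhoff T f n).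
Proof.
move=> fi; have mf : measurable_fun setT f.
  exact/measurable_EFinP/(measurable_int _ fi).
elim: n => [|n IH]; first exact: integrable0.
have h := integrableD measurableT fi (integrable_preserving mT muT IH).
apply: (le_integrable measurableT _ _ h).
  exact/measurable_EFinP/measurable_max_birkhoff.
move=> x _; rewrite /= lee_fin /Num.max; case: ifP => _ //.
by rewrite normr0.
Qed.

(** By ergodicity the running maxima [M n] are unbounded almost nowhere or
    almost everywhere.  In the second case [M n.+1 - M n \o T] tends to [f],
    is dominated by [|f|], and has nonnegative integral since [M n] is
    nondecreasing in [n] and [T] preserves the measure; this would force
    [f] to have nonnegative mean. *)
Lemma birkhoff_sum_bounded_above f : mu.-integrable setT (EFin \o f) ->
  (\int[mu]_x (f x)%:E < 0)%E ->
  {ae mu, forall x, exists K, forall n, birkhoff_sum T f n x <= K}.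
Proof.
move=> fi intf0; have mf : measurable_fun setT f.
  exact/measurable_EFinP/(measurable_int _ fi).
have mB := measurable_unbounded_birkhoff mf.
have [B0|B1] := ergT mB (unbounded_birkhoff_invariant T f).
  exists (unbounded_birkhoff T f); split => // x /= H K.
  apply: contrapT => h; apply: H; exists K%:R => n.
  rewrite (le_trans (birkhoff_sum_le_max _ _ _ _))// leNgt.
  by apply/negP => h'; apply: h; exists n.
exfalso; move: intf0; apply/negP; rewrite -leNgt.
pose D n x := (max_birkhoff T f n.+1 x - max_birkhoff T f n (T x))%:E.
have iM n := integrable_max_birkhoff n fi.
have iMT n := integrable_preserving mT muT (iM n).
have mD n : measurable_fun setT (D n).
  exact: (measurable_int _ (integrableB measurableT (iM n.+1) (iMT n))).
have mfE : measurable_fun setT (EFin \o f) by exact: measurable_int fi.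
have Dcvg : {ae mu, forall x, [set: Y] x -> D n x @[n --> \oo] --> (f x)%:E}.
  exists (~` unbounded_birkhoff T f); split; first exact: measurableC.
    by rewrite probability_setC// B1 subee.
  move=> x; apply: contra_not; rewrite -unbounded_birkhoff_invariant /= => H _.
  apply: cvg_near_cst; have [n hn] := H (Num.truncn `|f x|).+1.
  exists n => // m /= nm; rewrite /D max_birkhoffSB max_r//.
  have h1 := lt_trans (truncnS_gt _) hn.
  have h2 := max_birkhoff_nd T f (T x) nm.
  by have := ler_norm (- f x); rewrite normrN => ?; lra.
have dom : {ae mu, forall x n, [set: Y] x -> (`|D n x| <= `|(f x)%:E|)%E}.
  by apply: aeW => x n _; rewrite lee_fin max_birkhoffSB_bound.
have [_ _ cvgI] := dominated_convergence measurableT mD mfE Dcvg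
  (integrable_abse fi) dom.
rewrite -(cvg_lim _ cvgI)//; apply: lime_ge; first by apply/cvg_ex; eexists; exact: cvgI.
apply: nearW => n /=.
rewrite (_ : D n = (EFin \o max_birkhoff T f n.+1) \- ((EFin \o max_birkhoff T f n) \o T))%E//.
rewrite integralB// (integral_preserving mT muT)// sube_ge0; last first.
  by rewrite (integrable_fin_num measurableT (iM n)).
apply: le_integral => // x _; rewrite lee_fin; exact: max_birkhoff_nd.
Qed.

End birkhoff.

Lemma cvg_mean_of_slopes (R : realType) (s : nat -> R) (c : R) :
  (forall m : nat, exists K, forall n, s n - n%:R * (c + m.+1%:R^-1) <= K) ->
  (forall m : nat, exists K, forall n, n%:R * (c - m.+1%:R^-1) - s n <= K) ->
  n%:R^-1 * s n @[n --> \oo] --> c.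
Proof.
move=> Hu Hl; apply/cvgrPdist_lt => e e0.
(* Half of e absorbs the slope 1/(m+1), the other half the constant K. *)
pose m := Num.truncn (2 / e).
have me : m.+1%:R^-1 < e / 2.
  rewrite -[e / 2]invrK ltf_pV2 ?posrE ?invr_gt0 ?divr_gt0//.
  by rewrite invf_div truncnS_gt.
have [K1 hK1] := Hu m; have [K2 hK2] := Hl m.
pose K := Num.max 1 (Num.max K1 K2).
have K0 : 0 < K by rewrite lt_max ltr01.
exists (Num.truncn (K * (2 / e))).+1 => // n /= hn.
have Kn : K * (2 / e) < n%:R.
  by rewrite (lt_le_trans (truncnS_gt _))// ler_nat.
have n0 : (0 : R) < n%:R.
  by rewrite (lt_trans _ Kn)// mulr_gt0// divr_gt0.
have Kn' : K < n%:R * (e / 2).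
  rewrite -ltr_pdivrMr ?divr_gt0// invf_div//.
have [k1 k2] : K1 <= K /\ K2 <= K by rewrite !le_max !lexx !orbT.
have {k1} := le_trans (hK1 n) k1; have {k2} := le_trans (hK2 n) k2.
set q := m.+1%:R^-1 in me * => h2 h1.
have hq : n%:R * q < n%:R * (e / 2) by rewrite ltr_pM2l.
have -> : c - n%:R^-1 * s n = n%:R^-1 * (n%:R * c - s n).
  by rewrite mulrBr mulKf ?gt_eqF.
rewrite normrM gtr0_norm ?invr_gt0// mulrC ltr_pdivrMr//.
by rewrite ltr_norml; apply/andP; split; lra.
Qed.

Section pointwise_ergodic_theorem.
Context d (Y : measurableType d) (R : realType) (mu : probability Y R).
Variable T : Y -> Y.
Hypothesis mT : measurable_fun [set: Y] T.
Hypothesis muT : forall B, measurable B -> mu (T @^-1` B) = mu B.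
Hypothesis ergT : forall B, measurable B -> T @^-1` B = B ->
  mu B = 0%E \/ mu B = 1%E.
Implicit Types f : Y -> R.

Let integrable_constant (c : R) : mu.-integrable setT (EFin \o (fun=> c)).
Proof. exact: finite_measure_integrable_cst. Qed.

Let integral_constant (c : R) : (\int[mu]_x c%:E = c%:E)%E.
Proof. by rewrite integral_cst//= probability_setT mule1. Qed.

(** The functions [f - (c + e)] and [(c - e) - f] have negative mean for every
    [e > 0], so that their Birkhoff sums are almost surely bounded above. *)
Theorem birkhoff_ae f (c : R) : mu.-integrable setT (EFin \o f) ->
  (\int[mu]_x (f x)%:E = c%:E)%E ->
  {ae mu, forall x, n%:R^-1 * birkhoff_sum T f n x @[n --> \oo] --> c}.
Proof.
move=> fi intf.
have hu : {ae mu, forall x (m : nat), exists K, forall n,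
    birkhoff_sum T f n x - n%:R * (c + m.+1%:R^-1) <= K}.
  apply: ae_foralln => m; pose g x := f x - (c + m.+1%:R^-1).
  have gi : mu.-integrable setT (EFin \o g).
    exact: (integrableB measurableT fi (integrable_constant _)).
  have intg : (\int[mu]_x (g x)%:E < 0)%E.
    rewrite (_ : (fun x => (g x)%:E) =
      (EFin \o f) \- (EFin \o (fun=> (c + m.+1%:R^-1)%R)))%E//.
    rewrite integralB// intf integral_constant -EFinB lte_fin.
    by rewrite subr_lt0 ltrDl invr_gt0 ltr0n.
  apply: filterS (birkhoff_sum_bounded_above mT muT ergT gi intg) => x [K hK].
  by exists K => n; rewrite -(birkhoff_sum_cst T _ n x) -birkhoff_sumB.
have hl : {ae mu, forall x (m : nat), exists K, forall n,
    n%:R * (c - m.+1%:R^-1) - birkhoff_sum T f n x <= K}.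
  apply: ae_foralln => m; pose g x := (c - m.+1%:R^-1) - f x.
  have gi : mu.-integrable setT (EFin \o g).
    exact: (integrableB measurableT (integrable_constant _) fi).
  have intg : (\int[mu]_x (g x)%:E < 0)%E.
    rewrite (_ : (fun x => (g x)%:E) =
      (EFin \o (fun=> (c - m.+1%:R^-1)%R)) \- (EFin \o f))%E//.
    rewrite integralB// intf integral_constant -EFinB lte_fin.
    by rewrite subr_lt0 gtrBl invr_gt0 ltr0n.
  apply: filterS (birkhoff_sum_bounded_above mT muT ergT gi intg) => x [K hK].
  by exists K => n; rewrite -(birkhoff_sum_cst T _ n x) -birkhoff_sumB.
apply: filterS2 hu hl => x; exact: cvg_mean_of_slopes.
Qed.

Lemma birkhoff_sum_integral f (c : R) n : mu.-integrable setT (EFin \o f) ->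
  (\int[mu]_x (f x)%:E = c%:E)%E ->
  mu.-integrable setT (EFin \o birkhoff_sum T f n) /\
  (\int[mu]_x (birkhoff_sum T f n x)%:E = (n%:R * c)%:E)%E.
Proof.
move=> fi intf; elim: n => [|n [IHi IH]].
  have -> : birkhoff_sum T f 0 = cst 0.
    by apply/funext => x; rewrite /birkhoff_sum big_ord0.
  by split; [exact: integrable0|rewrite mul0r integral0_eq].
have -> : EFin \o birkhoff_sum T f n.+1 =
    ((EFin \o f) \+ ((EFin \o birkhoff_sum T f n) \o T))%E.
  by apply/funext => x /=; rewrite birkhoff_sumS.
have iT := integrable_preserving mT muT IHi.
split; first exact: integrableD.
have -> : (fun x => (birkhoff_sum T f n.+1 x)%:E) =
    ((EFin \o f) \+ ((EFin \o birkhoff_sum T f n) \o T))%E.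
  by apply/funext => x /=; rewrite birkhoff_sumS.
rewrite integralD// (integral_preserving mT muT)//= intf IH -EFinD.
by congr EFin; rewrite -natr1; ring.
Qed.

Let birkhoff_mean f n x := n%:R^-1 * birkhoff_sum T f n x.

Let measurable_mean f n : measurable_fun setT f ->
  measurable_fun setT (birkhoff_mean f n).
Proof. by move=> mf; apply: measurable_funM => //; exact: measurable_birkhoff_sum. Qed.

(** Scheffe's argument: the averages of [f >= 0] have mean [c], so that the
    mean of [|average - c|] is twice that of the positive part of
    [c - average], which is dominated by the constant [c]. *)
Let ge0_birkhoff_L1 f (c : R) : (forall x, 0 <= f x) ->
  mu.-integrable setT (EFin \o f) -> (\int[mu]_x (f x)%:E = c%:E)%E ->
  (\int[mu]_x `|(birkhoff_mean f n x - c)%:E|)%E @[n --> \oo] --> 0%E.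
Proof.
move=> f0 fi intf.
have mf : measurable_fun setT f by exact/measurable_EFinP/(measurable_int _ fi).
have c0 : 0 <= c by rewrite -lee_fin -intf integral_ge0// => x _; rewrite lee_fin.
have A0 n x : 0 <= birkhoff_mean f n x.
  by rewrite mulr_ge0 ?invr_ge0// sumr_ge0.
pose G n x := Num.max 0 (c - birkhoff_mean f n x).
have mG n : measurable_fun setT (EFin \o G n).
  apply/measurable_EFinP; apply: measurable_maxr => //.
  by apply: measurable_funB => //; exact: measurable_mean.
have G_le n x : `|G n x| <= c.
  rewrite ger0_norm ?le_max ?lexx// ge_max c0 /= gerBl; exact: A0.
have Gcvg : {ae mu, forall x, [set: Y] x -> (EFin \o G n) x @[n --> \oo] --> 0%E}.
  apply: filterS (birkhoff_ae fi intf) => x cx _; apply/fine_cvgP.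
  split; first exact: nearW.
  have dist0 : `|c - birkhoff_mean f n x| @[n --> \oo] --> 0.
    by rewrite -(normr0 R) -(subrr c); apply: cvg_norm; apply: cvgB => //; exact: cvg_cst.
  apply: (squeeze_cvgr _ (cvg_cst 0) dist0); apply: nearW => n.
  by rewrite /= le_max lexx ge_max normr_ge0 ler_norm.
have [_ _ cvgG] := dominated_convergence measurableT mG
  (measurable_cst (0 : \bar R)) Gcvg (integrable_constant c)
  (aeW mu (fun x n _ => G_le n x)).
rewrite integral0_eq// in cvgG.
have cvg2 : ((2%:E * \int[mu]_x (G n x)%:E)%E @[n --> \oo] --> 0%E).
  by rewrite -(mule0 (2%:E : \bar R)); apply: cvgeZl.
apply: cvg_trans cvg2; apply: near_eq_cvg; exists 1%N => // n /= n1.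
have n0 : (n%:R : R) != 0 by rewrite pnatr_eq0 -lt0n.
have [iS intS] := birkhoff_sum_integral n fi intf.
have iA : mu.-integrable setT (EFin \o birkhoff_mean f n).
  exact: (integrableZl measurableT n%:R^-1 iS).
have intA : (\int[mu]_x (birkhoff_mean f n x)%:E = c%:E)%E.
  rewrite (_ : (fun x => _) = (fun x => n%:R^-1%:E * (birkhoff_sum T f n x)%:E))%E//.
  by rewrite integralZl// intS -EFinM mulKf.
have iG : mu.-integrable setT (EFin \o G n).
  apply: (le_integrable measurableT (mG n) _ (integrable_constant c)) => x _.
  by rewrite /= lee_fin (ger0_norm c0) G_le.
rewrite -integralZl//.
have iAc := integrableB measurableT iA (integrable_constant c).
(* |y| = 2 max(0, -y) + y at y = average - c; the second term has mean 0. *)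
transitivity (\int[mu]_x (2%:E * (G n x)%:E +
    ((EFin \o birkhoff_mean f n) \- (EFin \o (fun=> c))) x))%E.
  rewrite integralD//; last exact: integrableZl.
  by rewrite integralB// intA integral_constant subee// adde0.
apply: eq_integral => x _ /=; rewrite -EFinB -EFinM -EFinD; congr EFin.
rewrite /G /Num.max; case: ifP => h; first by rewrite ler0_norm; lra.
by rewrite ger0_norm; lra.
Qed.

Theorem birkhoff_L1 f (c : R) :
  mu.-integrable setT (EFin \o f) -> (\int[mu]_x (f x)%:E = c%:E)%E ->
  (\int[mu]_x `|(n%:R^-1 * birkhoff_sum T f n x - c)%:E|)%E @[n --> \oo] --> 0%E.
Proof.
move=> fi intf.
pose p x := Num.max (f x) 0; pose q x : R := Num.max (- f x) 0.
have mf : measurable_fun setT f by exact/measurable_EFinP/(measurable_int _ fi).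
have mp : measurable_fun setT p by apply: measurable_maxr.
have mq : measurable_fun setT q.
  by apply: measurable_maxr => //; exact: measurableT_comp.
have fpq : f = (fun x => p x - q x).
  by apply/funext => x; rewrite /p /q /Num.max; do 2 case: ifP => ?; lra.
have ip : mu.-integrable setT (EFin \o p).
  apply: le_integrable fi => //; first exact/measurable_EFinP.
  by move=> x _; rewrite /= lee_fin /p /Num.max; case: ifP => //; rewrite normr0.
have iq : mu.-integrable setT (EFin \o q).
  apply: le_integrable fi => //; first exact/measurable_EFinP.
  move=> x _; rewrite /= lee_fin /q /Num.max; case: ifP; rewrite ?normr0//.
  by rewrite normrN.
pose cp := fine (\int[mu]_x (p x)%:E)%E; pose cq := fine (\int[mu]_x (q x)%:E)%E.
have intp : (\int[mu]_x (p x)%:E = cp%:E)%E by rewrite fineK// integrable_fin_num.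
have intq : (\int[mu]_x (q x)%:E = cq%:E)%E by rewrite fineK// integrable_fin_num.
have cE : c = cp - cq.
  apply: EFin_inj; rewrite -intf EFinB -intp -intq.
  rewrite -integralB//; apply: eq_integral => x _.
  by rewrite -EFinB {1}fpq.
have p0 x : 0 <= p x by rewrite le_max lexx orbT.
have q0 x : 0 <= q x by rewrite le_max lexx orbT.
have := @cvgeD _ _ _ R _ _ 0%E 0%E isT (ge0_birkhoff_L1 p0 ip intp)
  (ge0_birkhoff_L1 q0 iq intq).
rewrite adde0 => cvgpq.
have mA g (e : R) n : measurable_fun setT g ->
    measurable_fun setT (fun x => `|(birkhoff_mean g n x - e)%:E|%E).
  move=> mg; do 2 apply: measurableT_comp => //.
  by apply: measurable_funB => //; exact: measurable_mean.
apply: (@squeeze_cvge _ _ _ _ (cst 0%E) _ (fun n =>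
  \int[mu]_x `|(birkhoff_mean p n x - cp)%:E| +
  \int[mu]_x `|(birkhoff_mean q n x - cq)%:E|)%E); [apply: nearW => n|exact: cvg_cst|exact: cvgpq].
rewrite integral_ge0//= -ge0_integralD//; [|exact: mA|exact: mA].
apply: ge0_le_integral => //; first exact: (mA f c n).
  by apply: emeasurable_funD; exact: mA.
move=> x _; rewrite -EFinD lee_fin.
have -> : n%:R^-1 * birkhoff_sum T f n x - c =
    (birkhoff_mean p n x - cp) - (birkhoff_mean q n x - cq).
  by rewrite /birkhoff_mean {1}fpq birkhoff_sumB cE; ring.
exact: ler_normB.
Qed.

End pointwise_ergodic_theorem.

(** * The law of a process on the space of sequences *)

Section sequence_space.
Context dS (S : measurableType dS).

Definition coordinate_sets : set (set (nat -> S)) :=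
  \bigcup_i preimage_set_system setT (fun x : nat -> S => x i) measurable.

Definition seqspace : Type := g_sigma_algebraType coordinate_sets.
HB.instance Definition _ := Measurable.on seqspace.

Lemma measurable_coordinate i :
  measurable_fun setT (fun x : seqspace => (x : nat -> S) i).
Proof.
by move=> _ B mB; apply: sub_sigma_algebra; exists i => //; exists B.
Qed.

Lemma measurable_to_seqspace d (T : measurableType d) (f : T -> seqspace) :
  (forall i, measurable_fun setT (fun x => (f x : nat -> S) i)) ->
  measurable_fun setT f.
Proof.
move=> mf; apply: (@measurability _ _ T seqspace setT f coordinate_sets erefl).
move=> _ [_ [i _ [B mB <-]] <-].
by rewrite !setTI; rewrite -[X in measurable X]setTI; exact: mf.
Qed.

Lemma measurable_shift : measurable_fun setT (@Defs.shift dS S : seqspace -> seqspace).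
Proof. by apply: measurable_to_seqspace => i; exact: measurable_coordinate. Qed.

Lemma iter_shift n (x : nat -> S) i : iter n (@Defs.shift dS S) x i = x (n + i)%N.
Proof. by elim: n i => //= n IH i; rewrite /Defs.shift IH addnS. Qed.

(** A generating pi-system; constraints on the first [n] coordinates only,
    given by a whole sequence of sets so that two rectangles intersect
    coordinatewise. *)
Definition rectangles : set (set seqspace) :=
  [set C | exists n (B : nat -> set S), (forall i, measurable (B i)) /\
     C = [set x : seqspace | forall i, (i < n)%N -> B i ((x : nat -> S) i)]].

Lemma measurable_rectangle C : rectangles C -> measurable C.
Proof.
move=> [n [B [mB ->]]].
rewrite (_ : mkset _ =
    \bigcap_(i in `I_n) ((fun x : seqspace => (x : nat -> S) i) @^-1` B i)).
  apply: fin_bigcap_measurable => // i _.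
  by rewrite -[X in measurable X]setTI; exact: measurable_coordinate.
by apply/seteqP; split => x /= h i; exact: h.
Qed.

Lemma rectangles_setI : setI_closed rectangles.
Proof.
move=> _ _ [m [B [mB ->]]] [n [C [mC ->]]].
exists (m + n)%N, (fun i => (if (i < m)%N then B i else setT) `&`
                          (if (i < n)%N then C i else setT)).
split=> [i|]; first by apply: measurableI; case: ifP.
apply/seteqP; split=> [x [hB hC] i _|x /= h].
  by split; case: ifP => // ?; [exact: hB|exact: hC].
split=> i im.
  by have [] := h i (leq_trans im (leq_addr _ _)); rewrite im.
by have [_] := h i (leq_trans im (leq_addl _ _)); rewrite im.
Qed.

Lemma measurable_rectanglesE : @measurable _ seqspace = <<s rectangles >>.
Proof.
apply/seteqP; split; last first.
  apply: smallest_sub; first exact: sigma_algebra_measurable.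
  exact: measurable_rectangle.
apply: smallest_sub; first exact: smallest_sigma_algebra.
move=> _ [i _ [B mB <-]]; apply: sub_sigma_algebra.
exists i.+1, (fun j => if j == i then B else setT).
split=> [j|]; first by case: ifP.
rewrite setTI; apply/seteqP; split=> [x Bx j _ /=|x /= h].
  by case: eqP => // ->.
by have := h i (ltnSn i); rewrite eqxx.
Qed.

End sequence_space.

Section process_law.
Context dO dS (Omega : measurableType dO) (S : measurableType dS) (R : realType).
Variables (Pr : probability Omega R) (X : nat -> {mfun Omega >-> S}).

Definition trajectory (w : Omega) : seqspace S := fun i => X i w.

Lemma measurable_trajectory : measurable_fun setT trajectory.
Proof. by apply: measurable_to_seqspace => i; exact: measurable_funP. Qed.

HB.instance Definition _ := isMeasurableFun.Build _ _ _ _ trajectory measurable_trajectory.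

Definition process_law : probability (seqspace S) R := distribution Pr trajectory.

(** Stationarity, applied to the first [n] coordinates and a time shift by one,
    says that both measures agree on rectangles. *)
Lemma stationary_shift_invariant (B : set (seqspace S)) :
  stationary Pr X -> measurable B ->
  process_law (@Defs.shift dS S @^-1` B) = process_law B.
Proof.
move=> HX mB.
pose sh : {mfun seqspace S >-> seqspace S} := mfun_Sub (mem_set (@measurable_shift _ S)).
pose p1 := distribution process_law sh.
suff : p1 B = process_law B by [].
apply: (measure_unique (@rectangles _ S) (fun=> setT)) => //.
- exact: measurable_rectanglesE.
- exact: rectangles_setI.
- move=> _; exists 0%N, (fun=> setT); split => //.
  by apply/seteqP; split.
- by apply/seteqP; split => x _ //; exists 0%N.
- move=> _ [n [C [mC ->]]].
  pose D : set (n.-tuple S) := [set t | forall i : 'I_n, C i (tnth t i)].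
  have mD : measurable D.
    rewrite (_ : D = \bigcap_(i in [set: 'I_n]) ((@tnth _ S ^~ i) @^-1` C i)).
      apply: fin_bigcap_measurable => // i _.
      by rewrite -[X in measurable X]setTI; exact: measurable_tnth.
    by apply/seteqP; split => t /= h i; [move=> _; exact: h|exact: (h i I)].
  have := HX n 1%N D mD; rewrite /pushforward.
  have blockE t : block X t n @^-1` D =
      [set w | forall i, (i < n)%N -> C i (X (t + i)%N w)].
    apply/seteqP; split => w /= h.
      by move=> i i_n; have := h (Ordinal i_n); rewrite /block tnth_mktuple.
    by move=> i; rewrite /block tnth_mktuple; exact: h.
  by rewrite !blockE.
- by move=> _; rewrite (_ : (_ < _)%E = (distribution process_law sh setT < +oo)%E)// probability_setT ltry.
Qed.

Lemma ergodic_shift_invariant (B : set (seqspace S)) :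
  ergodic Pr X -> measurable B -> @Defs.shift dS S @^-1` B = B ->
  process_law B = 0%E \/ process_law B = 1%E.
Proof. by move=> HX mB; exact: HX. Qed.

Lemma ae_process_law (P : seqspace S -> Prop) :
  {ae process_law, forall x, P x} -> {ae Pr, forall w, P (trajectory w)}.
Proof.
move=> [A [mA A0 PA]]; exists (trajectory @^-1` A); split.
- by rewrite -[X in measurable X]setTI; exact: measurable_trajectory.
- exact: A0.
- by move=> w /= nP; exact: PA.
Qed.

Lemma ge0_integral_process_law (f : seqspace S -> \bar R) :
  measurable_fun setT f -> (forall x, 0 <= f x)%E ->
  (\int[process_law]_x f x = \int[Pr]_w f (trajectory w))%E.
Proof.
by move=> mf f0; rewrite (ge0_integral_pushforward measurable_trajectory)// preimage_setT.
Qed.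

Lemma measurable_first_pair :
  measurable_fun setT (fun x : seqspace S => ((x : nat -> S) 0%N, (x : nat -> S) 1%N)).
Proof. by apply: measurable_fun_pair; exact: measurable_coordinate. Qed.

End process_law.

(** * Norms on matrices *)

Section norm_comparison.
Variable R : realType.

Lemma le_mx_norm m n (M : 'M[R]_(m, n)) i j : `|M i j| <= `|M|.
Proof.
rewrite [leRHS]/Num.Def.normr/= mx_normrE.
exact: (le_bigmax _ (fun ij : 'I_m * 'I_n => `|M ij.1 ij.2|) (i, j)).
Qed.

Lemma mx_norm_le m n (M : 'M[R]_(m, n)) (x : R) :
  0 <= x -> (forall i j, `|M i j| <= x) -> `|M| <= x.
Proof.
move=> x0 Mx; rewrite [leLHS]/Num.Def.normr/= mx_normrE.
by apply: bigmax_le => // -[i j] _; exact: Mx.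
Qed.

Lemma mx_norm_attained m n (M : 'M[R]_(m, n)) : M != 0 ->
  exists i j, `|M| = `|M i j|.
Proof.
rewrite -normr_eq0 => /mx_norm_neq0[[i j] ij]; exists i, j; exact: ij.
Qed.

Lemma mx_norm_outer d (u v : 'cV[R]_d) : `|u *m v^T| = `|u| * `|v|.
Proof.
have outerE i j : (u *m v^T) i j = u i 0 * v j 0.
  by rewrite mxE big_ord1 mxE.
apply/eqP; rewrite eq_le; apply/andP; split.
  apply: mx_norm_le => [|i j]; first exact: mulr_ge0.
  by rewrite outerE normrM ler_pM// le_mx_norm.
have [->|u0] := eqVneq u 0; first by rewrite normr0 mul0r.
have [->|v0] := eqVneq v 0; first by rewrite normr0 mulr0.
have [i [k ->]] := mx_norm_attained u0; have [j [l ->]] := mx_norm_attained v0.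
by rewrite !ord1 -normrM -outerE le_mx_norm.
Qed.

Lemma inner_le_mx_norm d (u v : 'cV[R]_d) :
  `|(u^T *m v) 0 0| <= d%:R * (`|u| * `|v|).
Proof.
rewrite mxE (le_trans (ler_norm_sum _ _ _))//.
have -> : d%:R * (`|u| * `|v|) = \sum_(i < d) `|u| * `|v|.
  by rewrite sumr_const card_ord mulr_natl.
by apply: ler_sum => i _; rewrite mxE normrM ler_pM// le_mx_norm.
Qed.

Variables (m n : nat) (N : 'M[R]_(m, n) -> R).
Hypothesis N_norm : is_norm N.

Lemma is_norm0 : N 0 = 0.
Proof. by rewrite -(scale0r 0) is_norm_homogeneous// normr0 mul0r. Qed.

Lemma is_normN x : N (- x) = N x.
Proof. by rewrite -scaleN1r is_norm_homogeneous// normrN1 mul1r. Qed.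

Lemma is_norm_ge0 x : 0 <= N x.
Proof.
have := is_norm_triangle N_norm x (- x).
by rewrite subrr is_norm0 is_normN -mulr2n pmulrn_lge0.
Qed.

Lemma is_norm_gt0 x : x != 0 -> 0 < N x.
Proof.
move=> x0; rewrite lt_neqAle is_norm_ge0 andbT eq_sym.
by apply: contra x0 => /eqP/(is_norm_definite N_norm) ->.
Qed.

Lemma is_norm_sum I (r : seq I) (F : I -> 'M[R]_(m, n)) :
  N (\sum_(i <- r) F i) <= \sum_(i <- r) N (F i).
Proof.
elim/big_ind2 : _ => [|x1 x2 y1 y2 h1 h2|//]; first by rewrite is_norm0.
by rewrite (le_trans (is_norm_triangle N_norm _ _))// lerD.
Qed.

Lemma is_norm_le_entries : exists2 C : R, 0 < C &
  forall M, N M <= C * \sum_(ij : 'I_m * 'I_n) `|M ij.1 ij.2|.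
Proof.
pose C : R := 1 + \sum_(ij : 'I_m * 'I_n) N (delta_mx ij.1 ij.2).
have C0 : 0 < C by rewrite ltr_pwDl// sumr_ge0// => *; exact: is_norm_ge0.
exists C => // M; rewrite {1}(matrix_sum_delta M) pair_bigA /=.
rewrite (le_trans (is_norm_sum _ _))// mulr_sumr ler_sum// => ij _.
rewrite is_norm_homogeneous// mulrC; apply: ler_wpM2r => //.
rewrite /C (bigD1 ij)//= addrCA lerDl addr_ge0// sumr_ge0// => *.
exact: is_norm_ge0.
Qed.

Lemma is_norm_le_mx_norm : exists2 C : R, 0 < C & forall M, N M <= C * `|M|.
Proof.
have [C C0 NC] := is_norm_le_entries.
exists (C * (m * n).+1%:R) => [|M]; first by rewrite mulr_gt0.
rewrite (le_trans (NC M))// -mulrA ler_pM2l//.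
apply: (@le_trans _ _ (\sum_(ij : 'I_m * 'I_n) `|M|)).
  by apply: ler_sum => ij _; exact: le_mx_norm.
rewrite sumr_const card_prod !card_ord -[leLHS]mulr_natl; apply: ler_wpM2r => //.
by rewrite ler_nat.
Qed.

Lemma is_norm_dist x y : `|N x - N y| <= N (x - y).
Proof.
rewrite ler_norml lerBrDr lerBlDr addrC lerBlDr; apply/andP; split.
  rewrite -(is_normN (x - y)) opprB; apply: le_trans (is_norm_triangle N_norm _ _).
  by rewrite addrC subrK.
by apply: le_trans (is_norm_triangle N_norm _ _); rewrite subrK.
Qed.

(** [N] is continuous for the maximum norm and does not vanish on its unit
    sphere, which is compact by Heine-Borel on row vectors, to which matrices
    are flattened. *)
Lemma mx_norm_le_is_norm : exists2 c : R, 0 < c & forall M, c * `|M| <= N M.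
Proof.
pose g (x : 'rV[R]_(m * n)) : R := N (vec_mx x).
have [C C0 NC] := is_norm_le_mx_norm.
have vec_le (x : 'rV[R]_(m * n)) : `|vec_mx x| <= `|x|.
  by apply: mx_norm_le => // i j; rewrite mxE le_mx_norm.
have cg : continuous g.
  move=> x; apply/(cvgrPdist_lt (FF := nbhs_filter x)) => e e0.
  have h : nbhs x (ball x (e / C)) by apply: nbhsx_ballx; rewrite divr_gt0.
  apply: (@filterS _ _ (nbhs_filter x) _ _ _ h) => y.
  rewrite mx_norm_ball /ball_ /=; rewrite ltr_pdivlMr// mulrC; apply: le_lt_trans.
  rewrite (le_trans (is_norm_dist _ _))// -raddfB (le_trans (NC _))//.
  by rewrite ler_pM2l// vec_le.
pose K := [set x : 'rV[R]_(m * n) | `|x| = 1].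
have cK : compact K.
  apply: bounded_closed_compact.
    exists 1; split => // M M1 x /= ->; exact: ltW.
  have := (continuous_closedP (@Num.norm R 'rV[R]_(m * n))).1 _ [set 1].
  by apply; [exact: norm_continuous|exact: closed_eq].
have cgK : closed (g @` K).
  apply: compact_closed; first exact: norm_hausdorff.
  apply: continuous_compact => //.
  exact: continuous_subspaceT.
have gK0 : ~ (g @` K) 0.
  move=> [x /= x1] /(is_norm_definite N_norm)/(congr1 mxvec).
  by rewrite vec_mxK linear0 => /eqP; rewrite -normr_eq0 x1 oner_eq0.
have : nbhs (0 : R) (~` (g @` K)) by apply: open_nbhs_nbhs; split => //; exact: closed_openC.
move=> /nbhs_ballP[c /= c0 hc]; exists c => // M.
have [->|M0] := eqVneq M 0; first by rewrite normr0 mulr0 is_norm_ge0.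
pose x := mxvec M.
have x0 : x != 0 by rewrite /x mxvec_eq0.
have nx : 0 < `|x| by rewrite normr_gt0.
have gx : c <= g (`|x|^-1 *: x).
  rewrite leNgt; apply/negP => gc; apply: (hc (g (`|x|^-1 *: x))).
    by rewrite /ball/= sub0r normrN ger0_norm// is_norm_ge0.
  exists (`|x|^-1 *: x) => //=.
  by rewrite /K /= mx_normZ ger0_norm ?invr_ge0// mulVf// gt_eqF.
move: gx; rewrite /g linearZ/= mxvecK is_norm_homogeneous//.
rewrite ger0_norm ?invr_ge0// mulrC ler_pdivlMr//; apply: le_trans.
by rewrite ler_pM2l// -{1}(mxvecK M) vec_le.
Qed.

Lemma is_norm_ln_comparison : exists C : R, forall M, M != 0 ->
  `|ln (N M) - ln `|M| | <= C.
Proof.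
have [C C0 NC] := is_norm_le_mx_norm; have [c c0 cN] := mx_norm_le_is_norm.
exists (`|ln C| + `|ln c|) => M M0.
have nM : 0 < `|M| by rewrite normr_gt0.
have hu : ln (N M) <= ln C + ln `|M|.
  by rewrite -lnM ?posrE// ler_ln ?posrE ?mulr_gt0// is_norm_gt0.
have hl : ln c + ln `|M| <= ln (N M).
  by rewrite -lnM ?posrE// ler_ln ?posrE ?mulr_gt0// is_norm_gt0.
have := ler_norm (ln C); have := ler_norm (- ln c); rewrite normrN.
have := normr_ge0 (ln C); have := normr_ge0 (ln c) => ? ? ? ?.
by rewrite ler_norml; apply/andP; split; lra.
Qed.

End norm_comparison.

(** * Measurability of matrix-valued maps *)

Section measurability_of_norms.
Variable R : realType.

Lemma measurable_continuous_borel (T : ptopologicalType) (f : T -> R) :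
  continuous f ->
  measurable_fun (setT : set (g_sigma_algebraType (@open T))) f.
Proof.
move=> /continuousP cf.
apply: (@measurability _ _ (g_sigma_algebraType (@open T)) R setT f _
  (RGenOInfty.measurableE R)).
move=> _ [_ [x ->] <-]; rewrite setTI; apply: sub_sigma_algebra.
by apply: cf; exact: interval_open.
Qed.

Lemma measurable_colvec_entry d i :
  measurable_fun (setT : set (colvec R d)) (fun x => (x : 'cV[R]_d) i 0).
Proof. by apply: measurable_continuous_borel; exact: coord_continuous. Qed.

Lemma measurable_colvec_norm d :
  measurable_fun (setT : set (colvec R d)) (fun x => `|x : 'cV[R]_d|).
Proof. by apply: measurable_continuous_borel; exact: norm_continuous. Qed.

Lemma measurable_outer_entry d i j :
  measurable_fun (setT : set (outer R d)) (fun A => outer_mx A i j).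
Proof.
apply: measurable_continuous_borel => A.
apply: (@continuous_comp (outer_type R d) 'M[R]_d R (@outer_mx R d)
  (fun M => M i j)); last exact: coord_continuous.
exact: initial_continuous.
Qed.

Lemma measurable_lne_EFin : measurable_fun [set: R] (fun x => lne x%:E).
Proof.
rewrite (_ : (fun x => _) = (fun x => if x <= 0 then -oo%E else (ln x)%:E))//.
apply: measurable_fun_ifT => //; first exact: measurable_fun_ler.
by apply: measurableT_comp => //; exact: measurable_ln.
Qed.

(** Since [N (M - Q)] is at most a multiple [dist M Q] of the sum of the
    absolute values of the entries of [M - Q], the norm [N M] is the infimum
    of [N Q + dist M Q] over the countably many rational matrices [Q]. *)
Lemma measurable_is_norm d (Y : measurableType d) m n (N : 'M[R]_(m, n) -> R)
    (M : Y -> 'M[R]_(m, n)) : is_norm N ->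
  (forall i j, measurable_fun setT (fun y => M y i j)) ->
  measurable_fun setT (fun y => N (M y)).
Proof.
move=> N_norm mM; have [C C0 NC] := is_norm_le_entries N_norm.
apply: (measurability _ (RGenInftyO.measurableE R)) => _ [_ [t ->] <-].
pose dist (P Q : 'M[R]_(m, n)) := C * \sum_(ij : 'I_m * 'I_n) `|P ij.1 ij.2 - Q ij.1 ij.2|.
have distE P Q : N (P - Q) <= dist P Q.
  by rewrite (le_trans (NC _))// ler_pM2l// ler_sum// => ij _; rewrite !mxE.
pose F (Q : 'M[rat]_(m, n)) y := N (map_mx ratr Q) + dist (M y) (map_mx ratr Q).
have mF Q : measurable_fun setT (F Q).
  apply: measurable_funD => //; apply: measurable_funM => //.
  apply: measurable_sum => ij; apply: measurableT_comp => //.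
  exact: measurable_funB.
rewrite setTI (_ : _ @^-1` _ = \bigcup_Q (F Q @^-1` `]-oo, t[)).
  apply: countable_bigcupT_measurable => [|Q]; first exact: countableP.
  by rewrite -[X in measurable X]setTI; apply: mF => //; exact: measurable_itv.
apply/seteqP; split => y /=; rewrite in_itv/=; last first.
  move=> [Q _] /=; rewrite in_itv/=; apply: le_lt_trans.
  rewrite -{1}(subrK (map_mx ratr Q) (M y)) addrC.
  by rewrite (le_trans (is_norm_triangle N_norm _ _))// lerD2l distE.
move=> Nt; pose e := (t - N (M y)) / (2 * C * (m * n).+1%:R).
have e0 : 0 < e by rewrite divr_gt0 ?subr_gt0// !mulr_gt0.
have H i j : exists q : rat, `|M y i j - ratr q| <= e.
  have : M y i j - e < M y i j + e by rewrite ltrBlDr -addrA ltrDl addr_gt0.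
  move=> /rat_in_itvoo[q]; rewrite in_itv/= => /andP[h1 h2]; exists q.
  by rewrite ler_norml; apply/andP; split; lra.
pose Q := \matrix_(i, j) sval (cid (H i j)).
exists Q => //=; rewrite in_itv/=.
have distQ : dist (M y) (map_mx ratr Q) * 2 < t - N (M y).
  apply: (@le_lt_trans _ _ (C * (e * (m * n)%:R) * 2)).
    rewrite ler_pM2r// ler_pM2l//.
    apply: (@le_trans _ _ (\sum_(ij : 'I_m * 'I_n) e)).
      by apply: ler_sum => ij _; rewrite !mxE; exact: svalP (cid (H _ _)).
    by rewrite sumr_const card_prod !card_ord mulr_natr.
  rewrite (_ : t - N (M y) = C * (e * (m * n).+1%:R) * 2).
    by rewrite ltr_pM2r// ltr_pM2l// ltr_pM2l// ltr_nat.
  have : (0 : R) < (m * n).+1%:R by rewrite ltr0n.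
  rewrite /e; move: (_.+1%:R) => k k0; field.
  by rewrite !gt_eqF.
have h : N (map_mx ratr Q) <= N (M y) + dist (M y) (map_mx ratr Q).
  rewrite -{1}(subrK (M y) (map_mx ratr Q)) addrC.
  rewrite (le_trans (is_norm_triangle N_norm _ _))// lerD2l.
  by rewrite -(is_normN N_norm) opprB distE.
by rewrite /F; lra.
Qed.

End measurability_of_norms.

(** * Products of rank-one matrices *)

Section rank_one_products.
Variables (R : realType) (d : nat).

(** Each inner factor [(v i.+1)^T *m u i] is a scalar. *)
Lemma lprod_outer (A : nat -> 'M[R]_d) (u v : nat -> 'cV[R]_d) :
  (forall i, A i = u i *m (v i)^T) -> forall n,
  lprod A n.+1 =
    (\prod_(i < n) ((u i)^T *m v i.+1) 0 0) *: (u n *m (v 0%N)^T).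
Proof.
move=> AE; elim=> [|n IH]; first by rewrite big_ord0 scale1r /= mulmx1 AE.
rewrite [LHS]/= -[A n *m _]/(lprod A n.+1) IH -scalemxAr AE big_ord_recr /=.
rewrite -scalerA; congr (_ *: _).
rewrite -mulmxA (mulmxA _ (u n)) -(trmxK ((v n.+1)^T *m u n)) trmx_mul trmxK.
by rewrite [X in X^T]mx11_scalar tr_scalar_mx mul_scalar_mx -scalemxAr.
Qed.

Lemma ln_prod n (c : 'I_n -> R) : (forall i, 0 < c i) ->
  ln (\prod_i c i) = \sum_i ln (c i).
Proof.
move=> c0; suff [] : 0 < \prod_i c i /\ ln (\prod_i c i) = \sum_i ln (c i) by [].
apply: (big_ind2 (fun x y => 0 < x /\ ln x = y)) => [|x1 y1 x2 y2|i _ //].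
  by rewrite ln1.
by move=> [h1 <-] [h2 <-]; rewrite lnM ?posrE// mulr_gt0.
Qed.

End rank_one_products.

(** * Sequences controlled by Birkhoff averages *)

Section birkhoff_perturbation.
Context d (Y : measurableType d) (R : realType) (mu : probability Y R).
Variable T : Y -> Y.
Hypothesis mT : measurable_fun [set: Y] T.
Hypothesis muT : forall B, measurable B -> mu (T @^-1` B) = mu B.
Hypothesis ergT : forall B, measurable B -> T @^-1` B = B ->
  mu B = 0%E \/ mu B = 1%E.
Variables (h G : Y -> R) (lam : R) (L : nat -> Y -> \bar R).
Hypothesis ih : mu.-integrable setT (EFin \o h).
Hypothesis inth : (\int[mu]_x (h x)%:E = lam%:E)%E.
Hypothesis iG : mu.-integrable setT (EFin \o G).
Hypothesis G0 : forall x, 0 <= G x.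
Hypothesis mL : forall n, measurable_fun setT (L n).
Hypothesis Lbound : {ae mu, forall x n, (`|L n.+1 x - lam%:E| <=
  (`|n%:R^-1 * birkhoff_sum T h n x - lam| + n.+1%:R^-1 * G x)%:E)%E}.

Let mh : measurable_fun setT h.
Proof. exact/measurable_EFinP/(measurable_int _ ih). Qed.

Let mG : measurable_fun setT G.
Proof. exact/measurable_EFinP/(measurable_int _ iG). Qed.

Lemma perturbation_ae : {ae mu, forall x, L n x @[n --> \oo] --> lam%:E}.
Proof.
apply: filterS2 (birkhoff_ae mT muT ergT ih inth) Lbound => x cx bx.
rewrite -(cvg_shiftS (L ^~ x)).
suff : `|L n.+1 x - lam%:E|%E @[n --> \oo] --> 0%E.
  by move/cvg_abse0P/sube_cvg0; apply.
pose b n := `|n%:R^-1 * birkhoff_sum T h n x - lam| + n.+1%:R^-1 * G x.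
have b0 : b n @[n --> \oo] --> 0.
  rewrite -[0 in X in _ --> X](addr0 (0 : R)); apply: cvgD.
    rewrite -(normr0 R) -(subrr lam); apply: cvg_norm; apply: cvgB => //.
    exact: cvg_cst.
  by rewrite -(mul0r (G x)); apply: cvgM; [exact: cvg_harmonic|exact: cvg_cst].
apply: (@squeeze_cvge _ _ _ _ (cst 0%E) _ (fun n => (b n)%:E)).
- by apply: nearW => n; rewrite abse_ge0/= bx.
- exact: cvg_cst.
- by apply/fine_cvgP; split; [exact: nearW|exact: b0].
Qed.

Let mbound n : measurable_fun setT (fun x =>
  (`|n%:R^-1 * birkhoff_sum T h n x - lam| + n.+1%:R^-1 * G x)%:E).
Proof.
apply/measurable_EFinP; apply: measurable_funD; last exact: measurable_funM.
apply: measurableT_comp => //; apply: measurable_funB => //.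
by apply: measurable_funM => //; exact: measurable_birkhoff_sum.
Qed.

Let mdiff n : measurable_fun setT (fun x => `|L n x - lam%:E|)%E.
Proof. by apply: measurableT_comp => //; exact: emeasurable_funB. Qed.

(** This single estimate yields both integrability and convergence in L1. *)
Let int_diff_le n : (\int[mu]_x `|L n.+1 x - lam%:E| <=
  \int[mu]_x `|(n%:R^-1 * birkhoff_sum T h n x - lam)%:E| +
  n.+1%:R^-1%:E * \int[mu]_x (G x)%:E)%E.
Proof.
apply: (@le_trans _ _ (\int[mu]_x
  (`|n%:R^-1 * birkhoff_sum T h n x - lam| + n.+1%:R^-1 * G x)%:E))%E.
  apply: ae_ge0_le_integral => //.
    by move=> x _; rewrite lee_fin addr_ge0// mulr_ge0.
  by apply: filterS Lbound => x bx _; exact: bx.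
rewrite -ge0_integralZl//; last first.
- by move=> x _; rewrite lee_fin.
- exact/measurable_EFinP.
rewrite -ge0_integralD//.
- apply/measurable_EFinP; apply: measurableT_comp => //.
  apply: measurable_funB => //.
  by apply: measurable_funM => //; exact: measurable_birkhoff_sum.
- by move=> x _; rewrite lee_fin mulr_ge0.
- by apply/measurable_EFinP; exact: measurable_funM.
Qed.

Lemma perturbation_integrable n : mu.-integrable setT (L n.+1).
Proof.
have iD : mu.-integrable setT (fun x => L n.+1 x - lam%:E)%E.
  apply/integrableP; split; first exact: emeasurable_funB.
  apply: le_lt_trans (int_diff_le n) _; rewrite lte_add_pinfty//; last first.
    rewrite -integralZl//; apply: integrable_lty => //; exact: integrableZl.
  apply: integrable_lty => //.
  have [iS _] := birkhoff_sum_integral mT muT n ih inth.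
  have iA := integrableZl measurableT n%:R^-1 iS.
  have ilam : mu.-integrable setT (EFin \o (fun=> lam)).
    exact: finite_measure_integrable_cst.
  exact: (integrable_abse (integrableB measurableT iA ilam)).
have ilam : mu.-integrable setT (EFin \o (fun=> lam)).
  exact: finite_measure_integrable_cst.
have := integrableD measurableT iD ilam.
by apply: eq_integrable => // x _; exact: subeK.
Qed.

Lemma perturbation_L1 :
  (\int[mu]_x `|L n x - lam%:E|)%E @[n --> \oo] --> 0%E.
Proof.
rewrite -(cvg_shiftS (fun n => \int[mu]_x `|L n x - lam%:E|)%E).
suff : (\int[mu]_x `|L n.+1 x - lam%:E|)%E @[n --> \oo] --> 0%E by [].
have c1 := birkhoff_L1 mT muT ergT ih inth.
have finG : (\int[mu]_x (G x)%:E \is a fin_num)%E by exact: integrable_fin_num.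
have c2 : (n.+1%:R^-1%:E * \int[mu]_x (G x)%:E)%E @[n --> \oo] --> 0%E.
  rewrite -(fineK finG) -(mul0e (fine (\int[mu]_x (G x)%:E))%:E).
  apply: cvgeZr => //; apply/fine_cvgP; split; first exact: nearW.
  exact: cvg_harmonic.
have c12 := @cvgeD _ _ _ R _ _ 0%E 0%E isT c1 c2.
rewrite adde0 in c12.
apply: (@squeeze_cvge _ _ _ _ (cst 0%E) _ (fun n =>
  \int[mu]_x `|(n%:R^-1 * birkhoff_sum T h n x - lam)%:E| +
  n.+1%:R^-1%:E * \int[mu]_x (G x)%:E)%E);
  [apply: nearW => n|exact: cvg_cst|exact: c12].
by rewrite integral_ge0//= int_diff_le.
Qed.

End birkhoff_perturbation.

Section ae_finite_part.
Context d (Y : measurableType d) (R : realType) (mu : probability Y R).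

Lemma ae_eq_integrable (F : Y -> \bar R) (f : Y -> R) :
  measurable_fun setT f -> mu.-integrable setT F ->
  {ae mu, forall x, F x = (f x)%:E} ->
  mu.-integrable setT (EFin \o f) /\
  (\int[mu]_x (f x)%:E = \int[mu]_x F x)%E.
Proof.
move=> mf iF Ff; have mF := measurable_int _ iF.
have mfE : measurable_fun setT (EFin \o f) by exact/measurable_EFinP.
split; last first.
  by apply: ae_eq_integral => //; apply: filterS Ff => x ->.
apply/integrableP; split => //.
move/integrableP : iF => [_]; apply: le_lt_trans; rewrite le_eqVlt; apply/orP; left.
apply/eqP/ae_eq_integral => //; [exact: measurableT_comp|exact: measurableT_comp|].
by apply: filterS Ff => x ->.
Qed.

(** An integrable logarithm is almost surely finite; hence the extended
    logarithm may be replaced by the real one, which sends 0 to 0. *)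
Lemma lne_integrable (r : Y -> R) : (forall x, 0 <= r x) ->
  measurable_fun setT r -> mu.-integrable setT (fun x => lne (r x)%:E) ->
  [/\ {ae mu, forall x, 0 < r x}, mu.-integrable setT (EFin \o (@ln R \o r)) &
    (\int[mu]_x (ln (r x))%:E = \int[mu]_x lne (r x)%:E)%E].
Proof.
move=> r0 mr il.
have rpos : {ae mu, forall x, 0 < r x}.
  apply: filterS (integrable_ae measurableT il) => x /(_ I).
  by rewrite lt_neqAle r0 andbT eq_sym /lne; case: ifPn => //; rewrite -ltNge => /gt_eqF ->.
have mlr : measurable_fun setT (@ln R \o r) by exact: measurableT_comp.
have [] := @ae_eq_integrable _ (@ln R \o r) mlr il.
  by apply: filterS rpos => x rx; rewrite lne_EFin.
by split.
Qed.

End ae_finite_part.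

(** * Stationary sequences of rank-one matrices *)

Section rank_one_process.
Variables (R : realType) (d : nat) (N : 'M[R]_d -> R).
Hypothesis N_norm : is_norm N.
Variables u v : {mfun outer R d >-> colvec R d}.
Hypothesis uvE : forall A : outer R d,
  outer_mx A = (u A : 'cV[R]_d) *m (v A : 'cV[R]_d)^T.

Local Notation Y := (seqspace (outer R d)).
Local Notation T := (@Defs.shift _ (outer R d) : Y -> Y).

Let U (x : Y) (i : nat) : 'cV[R]_d := u ((x : nat -> outer R d) i).
Let V (x : Y) (i : nat) : 'cV[R]_d := v ((x : nat -> outer R d) i).

Definition inner (x : Y) : R := ((U x 0)^T *m V x 1%N) 0 0.
Definition log_left (x : Y) : R := ln `|U x 0|.
Definition first_mx (x : Y) : 'M[R]_d := outer_mx ((x : nat -> outer R d) 0%N).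
Definition mean_log (n : nat) (x : Y) : \bar R :=
  mean_log_norm N (fun i => outer_mx ((x : nat -> outer R d) i)) n.

Let U_iter x n i : U (iter n T x) i = U x (n + i)%N.
Proof. by rewrite /U iter_shift. Qed.

Let V_iter x n i : V (iter n T x) i = V x (n + i)%N.
Proof. by rewrite /V iter_shift. Qed.

Let first_mxE x : first_mx x = U x 0 *m (V x 0)^T.
Proof. exact: uvE. Qed.

Lemma measurable_log_left : measurable_fun setT log_left.
Proof.
have mU := measurableT_comp (measurable_funP u) (@measurable_coordinate _ (outer R d) 0%N).
exact: (measurableT_comp (@measurable_ln R) (measurableT_comp (@measurable_colvec_norm R d) mU)).
Qed.

Lemma measurable_inner_pair : measurable_fun [set: outer R d * outer R d]
  (fun AA' => ((u AA'.1 : 'cV[R]_d)^T *m (v AA'.2 : 'cV[R]_d)) 0 0).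
Proof.
rewrite (_ : (fun _ => _) = fun AA' : outer R d * outer R d =>
    \sum_(i < d) (u AA'.1 : 'cV[R]_d) i 0 * (v AA'.2 : 'cV[R]_d) i 0).
  apply: measurable_sum => i; apply: measurable_funM.
    have mu1 := measurableT_comp (measurable_funP u) (@measurable_fst _ _ (outer R d) (outer R d)).
    exact: (measurableT_comp (@measurable_colvec_entry R d i) mu1).
  have mv2 := measurableT_comp (measurable_funP v) (@measurable_snd _ _ (outer R d) (outer R d)).
  exact: (measurableT_comp (@measurable_colvec_entry R d i) mv2).
by apply/funext => AA'; rewrite mxE; apply: eq_bigr => i _; rewrite mxE.
Qed.

Lemma measurable_inner : measurable_fun setT inner.
Proof. exact: (measurableT_comp measurable_inner_pair (@measurable_first_pair _ (outer R d))). Qed.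

Lemma measurable_process_entry (n : nat) i j :
  measurable_fun setT (fun x : Y => outer_mx ((x : nat -> outer R d) n) i j).
Proof.
exact: (measurableT_comp (@measurable_outer_entry R d i j) (@measurable_coordinate _ (outer R d) n)).
Qed.

Lemma measurable_lprod_entry n i j : measurable_fun setT (fun x : Y =>
  lprod (fun k => outer_mx ((x : nat -> outer R d) k)) n i j).
Proof.
elim: n i j => [|n IH] i j /=; first exact: measurable_cst.
under eq_fun do rewrite mxE.
apply: measurable_sum => k; apply: measurable_funM => //.
exact: measurable_process_entry.
Qed.

Lemma measurable_mean_log n : measurable_fun setT (mean_log n).
Proof.
apply: emeasurable_funM => //.
have mN : measurable_fun setT (fun x : Y =>
    N (lprod (fun k => outer_mx ((x : nat -> outer R d) k)) n)).
  by apply: measurable_is_norm => // i j; exact: measurable_lprod_entry.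
exact: (measurableT_comp (@measurable_lne_EFin R) mN).
Qed.

(** With [B] the Birkhoff sum on the right, the telescoped product has
    logarithm [B + ln |A_0| + r], where [r] is the defect, at most [C], between
    [N] and the maximum norm on [u_n v_0^T].  The Birkhoff sum has one term
    less than the product has factors, whence the comparison of division by
    [n] and by [n.+1]. *)
Lemma mean_log_bound (C lam : R) (x : Y) :
  (forall M, M != 0 -> `|ln (N M) - ln `|M| | <= C) ->
  (forall n, inner (iter n T x) != 0) ->
  (forall n, first_mx (iter n T x) != 0) ->
  forall n : nat, (`|mean_log n.+1 x - lam%:E| <=
    (`|n%:R^-1 * birkhoff_sum T (fun y => ln `|inner y| +
        (log_left (T y) - log_left y)) n x - lam| +
     n.+1%:R^-1 * (C + `|lam| + `|ln `|first_mx x| |))%:E)%E.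
Proof.
move=> HC inner0 first0 n.
pose A i := outer_mx ((x : nat -> outer R d) i).
have AE i : A i = U x i *m (V x i)^T by exact: uvE.
pose c i : R := ((U x i)^T *m V x i.+1) 0 0.
have cE i : c i = inner (iter i T x).
  by rewrite /inner U_iter V_iter addn0 addn1.
have UV0 i : 0 < `|U x i| /\ 0 < `|V x i|.
  have := first0 i; rewrite first_mxE U_iter V_iter addn0.
  rewrite -normr_gt0 mx_norm_outer => h; split; rewrite normr_gt0.
    by apply: contraTN h => /eqP ->; rewrite normr0 mul0r ltxx.
  by apply: contraTN h => /eqP ->; rewrite normr0 mulr0 ltxx.
pose M := U x n *m (V x 0)^T.
have nM : `|M| = `|U x n| * `|V x 0| by exact: mx_norm_outer.
have M0 : M != 0 by rewrite -normr_gt0 nM mulr_gt0//; [exact: (UV0 n).1|exact: (UV0 _).2].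
have NE : N (lprod A n.+1) = (\prod_(i < n) `|c i|) * N M.
  rewrite (lprod_outer (u := U x) (v := V x))// is_norm_homogeneous//.
  by rewrite normr_prod.
have c0 (i : 'I_n) : 0 < `|c i| by rewrite normr_gt0 cE.
have prod0 : 0 < \prod_(i < n) `|c i| by apply: prodr_gt0 => i _.
have NM0 : 0 < N M by exact: is_norm_gt0.
set h := fun y => _ + _; set B := birkhoff_sum T h n x.
have BE : B = \sum_(i < n) ln `|c i| + (ln `|U x n| - ln `|U x 0|).
  rewrite /B birkhoff_sum_coboundary /log_left U_iter addn0; congr (_ + _).
  by apply: eq_bigr => i _; rewrite cE.
pose r := ln (N M) - ln `|M|.
have gE : ln `|first_mx x| = ln `|U x 0| + ln `|V x 0|.
  rewrite first_mxE mx_norm_outer lnM ?posrE//; [exact: (UV0 _).1|exact: (UV0 _).2].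
have lnE : ln (N (lprod A n.+1)) = B + ln `|first_mx x| + r.
  rewrite NE lnM ?posrE// ln_prod// BE gE /r nM lnM ?posrE//;
    [|exact: (UV0 _).1|exact: (UV0 _).2].
  by ring.
have rC : `|r| <= C by exact: HC.
rewrite /mean_log /mean_log_norm lne_EFin; last by rewrite NE mulr_gt0.
rewrite -EFinM -EFinB lee_fin lnE.
have n0 : (0 : R) < n.+1%:R by rewrite ltr0n.
have nB : n%:R * (n%:R^-1 * B) = B.
  rewrite /B; have [->|n_gt0] := posnP n.
    by rewrite /birkhoff_sum big_ord0 !mulr0.
  by rewrite mulrA mulfV ?mul1r// pnatr_eq0 -lt0n.
(* For n = 0 the average is 0 * 0^-1 and B is the empty sum, so nB holds
   without a case distinction below. *)
rewrite -{1}nB; move: (n%:R^-1 * B) => a.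
have -> : n.+1%:R^-1 * (n%:R * a + ln `|first_mx x| + r) - lam =
   n.+1%:R^-1 * (n%:R * (a - lam)) + n.+1%:R^-1 * (r - lam + ln `|first_mx x|).
  have : (n.+1%:R : R) != 0 by rewrite gt_eqF.
  by rewrite -natr1 => ?; field.
apply: le_trans (ler_normD _ _) _; apply: lerD.
  rewrite !normrM gtr0_norm ?invr_gt0// mulrA; apply: ler_piMl => //.
  by rewrite ger0_norm// mulrC ler_pdivrMr// mul1r ler_nat.
rewrite normrM gtr0_norm ?invr_gt0// ler_pM2l ?invr_gt0//.
apply: le_trans (ler_normD _ _) _; rewrite lerD2r.
by apply: le_trans (ler_normB _ _) _; rewrite lerD2r.
Qed.

(** The upper bound which makes the coboundary of [log_left] integrable
    although [log_left] itself need not be. *)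
Lemma log_left_coboundary_le (x : Y) : inner x != 0 -> first_mx x != 0 ->
  first_mx (T x) != 0 -> log_left (T x) - log_left x <=
    `|ln d%:R| + `|ln `|first_mx (T x)| | + `|ln `|inner x| |.
Proof.
rewrite -!normr_gt0 => c0; rewrite !first_mxE !mx_norm_outer => uv0 uv1.
have [V0 V1] : V (T x) 0%N = V x 1%N /\ U (T x) 0%N = U x 1%N by [].
rewrite V0 V1 in uv1 *.
have pos (y z : R) : 0 <= y -> 0 <= z -> 0 < y * z -> 0 < y /\ 0 < z.
  by rewrite !le_eqVlt => /predU1P[<-|?] /predU1P[<-|?]; rewrite ?mul0r ?mulr0 ?ltxx.
have [u0 _] := pos _ _ (normr_ge0 _) (normr_ge0 _) uv0.
have [u1 v1] := pos _ _ (normr_ge0 _) (normr_ge0 _) uv1.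
have cd := inner_le_mx_norm (U x 0) (V x 1%N); rewrite -/(inner x) in cd.
have [d0 _] := pos _ _ (ler0n _ _) (ltW (mulr_gt0 u0 v1)) (lt_le_trans c0 cd).
have : ln `|inner x| <= ln d%:R + (ln `|U x 0| + ln `|V x 1%N|).
  by rewrite -lnM ?posrE// -lnM ?posrE ?mulr_gt0// ler_ln ?posrE ?mulr_gt0.
rewrite lnM ?posrE// /log_left V1 => h.
have := ler_norm (ln d%:R : R); have := ler_norm (ln `|U x 1%N| + ln `|V x 1%N|).
have := ler_norm (- ln `|inner x|); rewrite normrN => ? ? ?; lra.
Qed.

End rank_one_process.

Theorem theorem5p1 (R : realType) (d : nat)
  (N : 'M[R]_d -> R) (N_norm : is_norm N)
  (dO : measure_display) (Omega : measurableType dO) (Pr : probability Omega R)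
  (X : nat -> {mfun Omega >-> outer R d})
  (u v : {mfun outer R d >-> colvec R d})
  (uvE : forall A : outer R d,
    outer_mx A = (u A : 'cV[R]_d) *m (v A : 'cV[R]_d)^T)
  (X_stationary : stationary Pr X)
  (X_ergodic : ergodic Pr X) :
  let log_inner := fun AA' : outer R d * outer R d =>
    lne (`|((u AA'.1 : 'cV[R]_d)^T *m (v AA'.2 : 'cV[R]_d)) 0 0|)%:E in
  let L := fun (k : nat) (w : Omega) =>
    mean_log_norm N (fun i => outer_mx (X i w)) k in
  let lambda := (\int[pair_law Pr X]_AA' log_inner AA')%E in
  (\int[Pr]_w `|lne (N (outer_mx (X 0%N w)))%:E| < +oo)%E ->
  (\int[pair_law Pr X]_AA' `|log_inner AA'| < +oo)%E ->
  [/\ {ae Pr, forall w, exists l : R, L k w @[k --> \oo] --> l%:E},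
      {ae Pr, forall w, L k w @[k --> \oo] --> lambda},
      (forall k, (0 < k)%N -> Pr.-integrable setT (L k)) &
      (\int[Pr]_w `|L k w - lambda|)%E @[k --> \oo] --> 0%E].
Proof.
move=> log_inner L lambda HN Hinner.
pose mu : probability (seqspace (outer R d)) R := process_law Pr X.
pose T : seqspace (outer R d) -> seqspace (outer R d) := @Defs.shift _ (outer R d).
have mT : measurable_fun setT T := @measurable_shift _ (outer R d).
have muT (B : set (seqspace (outer R d))) : measurable B -> mu (T @^-1` B) = mu B.
  by move=> mB; exact: stationary_shift_invariant.
have ergT (B : set (seqspace (outer R d))) : measurable B -> T @^-1` B = B ->
    mu B = 0%E \/ mu B = 1%E.
  by move=> mB; exact: ergodic_shift_invariant.
have mX01 : measurable_fun setT (fun w => (X 0%N w, X 1%N w)).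
  by apply: measurable_fun_pair; exact: measurable_funP.
have mlog : measurable_fun setT log_inner.
  have mabs := measurableT_comp (@normr_measurable R setT) (measurable_inner_pair u v).
  exact: (measurableT_comp (@measurable_lne_EFin R) mabs).
have minner := measurable_inner u v.
have mabs : measurable_fun setT (fun x => `|inner u v x|).
  exact: (measurableT_comp (@normr_measurable R setT) minner).
pose li (x : seqspace (outer R d)) : \bar R := lne (`|inner u v x|)%:E.
have mli : measurable_fun setT li.
  exact: (measurableT_comp (@measurable_lne_EFin R) mabs).
have abs_pair : (\int[mu]_x `|li x| = \int[pair_law Pr X]_AA' `|log_inner AA'|)%E.
  have mabsli : measurable_fun setT (abse \o li) by exact: measurableT_comp.
  have mabslog : measurable_fun setT (abse \o log_inner) by exact: measurableT_comp.
  transitivity (\int[Pr]_w `|li (trajectory X w)|)%E.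
    exact: (ge0_integral_process_law Pr X mabsli (fun x => abse_ge0 _)).
  rewrite /pair_law.
  have := @ge0_integral_pushforward _ _ _ _ R _ mX01 Pr setT (abse \o log_inner).
  by rewrite preimage_setT => /(_ measurableT mabslog (fun y _ => abse_ge0 _)) ->.
have il : mu.-integrable setT li.
  by apply/integrableP; split => //; rewrite abs_pair.
have iPr : Pr.-integrable setT (li \o trajectory X).
  apply/integrableP; split; first by apply: measurableT_comp.
  have mabsli : measurable_fun setT (abse \o li) by exact: measurableT_comp.
  have <- := ge0_integral_process_law Pr X mabsli (fun x => abse_ge0 _).
  by rewrite [X in (X < _)%E]abs_pair.
have lambdaE : (\int[mu]_x li x = lambda)%E.
  transitivity (\int[Pr]_w li (trajectory X w))%E.
    exact: (integral_distribution (X := trajectory X) mli iPr).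
  rewrite /lambda /pair_law.
  have := @integral_pushforward _ _ _ _ R _ mX01 Pr setT log_inner mlog.
  by rewrite preimage_setT => /(_ iPr measurableT) ->.
have mfirstN : measurable_fun setT (fun x : seqspace (outer R d) => N (first_mx x)).
  by apply: measurable_is_norm => // i j; exact: measurable_process_entry.
have iN : mu.-integrable setT (fun x => lne (N (first_mx x))%:E).
  apply/integrableP; split.
    exact: (measurableT_comp (@measurable_lne_EFin R) mfirstN).
  rewrite (ge0_integral_process_law Pr X
    (f := fun x => `|lne (N (first_mx x))%:E|%E))//.
  apply: measurableT_comp => //.
  exact: (measurableT_comp (@measurable_lne_EFin R) mfirstN).
have [inner_pos ilni intlni] := lne_integrable (fun x => normr_ge0 _) mabs il.
have [N_pos ilnN _] := lne_integrable (fun x => is_norm_ge0 N_norm _) mfirstN iN.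
have first0 : {ae mu, forall x, first_mx x != 0}.
  apply: filterS N_pos => x; apply: contraTN => /eqP ->.
  by rewrite (is_norm0 N_norm) ltxx.
have inner0 : {ae mu, forall x, inner u v x != 0}.
  by apply: filterS inner_pos => x; rewrite normr_gt0.
have first0' := ae_iter_preserving mT muT first0.
have inner0' := ae_iter_preserving mT muT inner0.
have [C HC] := is_norm_ln_comparison N_norm.
pose lam := fine lambda.
have lamE : lambda = lam%:E by rewrite fineK// -lambdaE integrable_fin_num.
pose f (x : seqspace (outer R d)) : R := ln `|inner u v x|; pose a : seqspace (outer R d) -> R := log_left u.
pose g (x : seqspace (outer R d)) : R := ln `|first_mx x|.
have ma : measurable_fun setT a := measurable_log_left u.
have mg : measurable_fun setT g.
  apply: (measurableT_comp (@measurable_ln R)).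
  apply: (measurable_is_norm (N := fun M : 'M[R]_d => `|M|)) => [|i j].
    by split; [exact: ler_normD|exact: mx_normZ|exact: normr0_eq0].
  exact: measurable_process_entry.
(* When first_mx x = 0 both real logarithms are 0. *)
have g_le x : `|g x| <= `|ln (N (first_mx x))| + `|C|.
  have [fx0|fx0] := eqVneq (first_mx x) 0.
    by rewrite /g fx0 normr0 ln0// normr0 addr_ge0.
  have := HC _ fx0; rewrite distrC => h; rewrite -lerBlDl.
  by rewrite (le_trans (lerB_dist _ _))// (le_trans h)// ler_norm.
have iC : mu.-integrable setT (EFin \o (fun=> `|C|)).
  exact: finite_measure_integrable_cst.
have ig : mu.-integrable setT (EFin \o g).
  apply: (le_integrable measurableT _ _ (integrableD measurableT (integrable_abse ilnN) iC)).
    exact/measurable_EFinP.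
  move=> x _; rewrite /= lee_fin; apply: le_trans (g_le x) _.
  exact: ler_norm.
pose phi x : R := `|ln d%:R| + `|g (T x)| + `|f x|.
have iphi : mu.-integrable setT (EFin \o phi).
  have id : mu.-integrable setT (EFin \o (fun=> `|ln d%:R : R|)).
    exact: finite_measure_integrable_cst.
  have igT := integrable_abse (integrable_preserving mT muT ig).
  exact: (integrableD measurableT (integrableD measurableT id igT) (integrable_abse ilni)).
have phi0 x : 0 <= phi x by rewrite !addr_ge0.
have aphi : {ae mu, forall x, a (T x) - a x <= phi x}.
  apply: filterS2 first0' inner0 => x fx cx.
  by apply: log_left_coboundary_le => //; [exact: (fx 0%N)|exact: (fx 1%N)].
have icob := coboundary_integrable mT muT ma iphi phi0 aphi.
have intcob := integral_coboundary mT muT ma iphi phi0 aphi.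
pose h x : R := f x + (a (T x) - a x).
have ih : mu.-integrable setT (EFin \o h) := integrableD measurableT ilni icob.
have inth : (\int[mu]_x (h x)%:E = lam%:E)%E.
  rewrite (_ : (fun x => _) = (EFin \o f) \+ (fun x => (a (T x) - a x)%:E))%E//.
  by rewrite integralD// intcob adde0 -lamE -lambdaE -intlni.
pose G x : R := `|C| + `|lam| + `|g x|.
have iG : mu.-integrable setT (EFin \o G).
  have il' : mu.-integrable setT (EFin \o (fun=> `|C| + `|lam|)).
    exact: finite_measure_integrable_cst.
  exact: (integrableD measurableT il' (integrable_abse ig)).
have G0 x : 0 <= G x by rewrite !addr_ge0.
have mL n : measurable_fun setT (mean_log N n).
  exact: measurable_mean_log.
have Lbound : {ae mu, forall x n, (`|mean_log N n.+1 x - lam%:E| <=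
    (`|n%:R^-1 * birkhoff_sum T h n x - lam| + n.+1%:R^-1 * G x)%:E)%E}.
  apply: filterS2 first0' inner0' => x fx cx n.
  apply: (mean_log_bound N_norm uvE) => // M M0.
  by apply: le_trans (HC M M0) _; exact: ler_norm.
have Lcvg : {ae Pr, forall w, L k w @[k --> \oo] --> lambda}.
  rewrite lamE; apply: (ae_process_law (X := X)
    (P := fun x => mean_log N n x @[n --> \oo] --> lam%:E)).
  exact: (perturbation_ae mT muT ergT ih inth Lbound).
split.
- by apply: filterS Lcvg => w; rewrite lamE; exists lam.
- exact: Lcvg.
- case=> // n _.
  have /integrableP[_ iL] := perturbation_integrable mT muT ih inth iG G0 mL Lbound n.
  apply/integrableP; split.
    exact: (measurableT_comp (mL n.+1) (measurable_trajectory X)).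
  move: iL; rewrite (ge0_integral_process_law Pr X
    (f := fun x => `|mean_log N n.+1 x|%E))//.
  exact: measurableT_comp.
- rewrite lamE.
  have := perturbation_L1 mT muT ergT ih inth iG G0 mL Lbound.
  apply: cvg_trans; apply: near_eq_cvg; apply: nearW => n.
  rewrite (ge0_integral_process_law Pr X
    (f := fun x => `|mean_log N n x - lam%:E|%E))//.
  by apply: measurableT_comp => //; exact: emeasurable_funB.
Qed.
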